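(* For all $0\le n<i\le N$ and $x\in\mathbb{R}$, the crossing time probability $P_{t_n,t_i}(x)=\Pr(\tau_{t_n}(x)=t_i)$ satisfies $$P_{t_n,t_i}(x) = F\big(-\widehat{\mathbf{B}}_{t_n,t_i}(x),\Sigma_{t_n,t_i}\big) - F\big(-\mathbf{B}_{t_n,t_i}(x),\Sigma_{t_n,t_i}\big),$$ where $F(\mathbf{a},\Sigma)$ is the cumulative distribution function, evaluated at the vector $\mathbf{a}$, of a standard multivariate normal vector (zero means, unit variances) with covariance matrix $\Sigma$.
   Context: Model. A single item must be purchased within a finite horizon $[0,T]$. Decisions are made on the grid $t_n = n\cdot dt$, $0\le n\le N$, with $dt>0$ and $N=T/dt$. The item's price follows the AR(1) process $X_t = \theta K\,dt + (1-K\,dt)X_{t-dt} + \sigma\varepsilon_t$, where $\theta\in\mathbb{R}$, $\sigma>0$, $|1-K\,dt|<1$, and the $\varepsilon_{t_1},\varepsilon_{t_2},\dots$ are i.i.d. $N(0,dt)$. For $t_n<t_i$, $X_{t_n,t_i}(x)$ denotes the random price $X_{t_i}$ conditioned on $X_{t_n}=x$, i.e. $$X_{t_n,t_i}(x)=\theta+(x-\theta)(1-dt\,K)^{i-n}+\sigma\sum_{j=0}^{i-n-1}(1-dt\,K)^j\varepsilon_{t_{i-j}}.$$ Holding the item from $t_n$ to $t_N$ costs $dt\sum_{i=n}^{N-1}h_{t_i}$, where the per-unit-time holding costs $h_{t_0},\dots,h_{t_{N-1}}$ are real numbers that are weakly decreasing in time. Value function. $V(x,t_N)=x$, and for $0\le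 n<N$, $V(x,t_n)=\min\{V^C(x,t_n),\, x+dt\sum_{i=n}^{N-1}h_{t_i}\}$ with $V^C(x,t_n)=E[V(X_{t_n,t_{n+1}}(x),t_{n+1})]$. Threshold. For $0\le n\le N-1$, $b(t_n)$ is the (single) real number with $V^C(b(t_n),t_n)=b(t_n)+dt\sum_{i=n}^{N-1}h_{t_i}$; by convention $b(t_N)=\infty$. Crossing time. $\tau_{t_n}(x)=\inf\{t_i>t_n : X_{t_n,t_i}(x)\le b(t_i)\}$. Standardization. $X_{t_n,t_i}(x)$ is normal with mean $\mu_{t_n,t_i}(x)=\theta+(x-\theta)(1-dt\,K)^{i-n}$ and variance $\sigma^2_{t_n,t_i}=dt\,\sigma^2\frac{1-(1-dt K)^{2(i-n)}}{1-(1-dt K)^2}$. Put $Z_{t_n,t_i}(x)=(X_{t_n,t_i}(x)-\mu_{t_n,t_i}(x))/\sigma_{t_n,t_i}$. $\Sigma_{t_n,t_i}$ is the covariance matrix of $(Z_{t_n,t_{n+1}}(x),\dots,Z_{t_n,t_i}(x))$, whose entries are, for $n+1\le l\le k\le i$, $$\mathrm{cov}(Z_{t_n,t_l}(x),Z_{t_n,t_k}(x))=\frac{dt\,\sigma^2(1-dt K)^{k-l}}{\sigma_{t_n,t_l}\sigma_{t_n,t_k}}\cdot\frac{1-(1-dt K)^{2(l-n)}}{1-(1-dt K)^2}.$$ Standardized thresholds: $\beta_{t_n,t_l}(x)=\big(b(t_l)-\mu_{t_n,t_l}(x)\big)/\sigma_{t_n,t_l}$ for $n+1\le l\le i$; $\mathbf{B}_{t_n,t_i}(x)=[\beta_{t_n,t_{n+1}}(x),\dots,\beta_{t_n,t_i}(x)]$;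 and $\widehat{\mathbf{B}}_{t_n,t_i}(x)$ is the same vector with its last entry (the one for $t_i$) replaced by $-\infty$. $F$ is extended to vectors with entries $\pm\infty$ in the usual way (probability that each coordinate is at most the given extended real). *)

(* Defs.v *)
(* MathComp-Analysis. *)
From HB Require Import structures.
From mathcomp Require Import all_boot all_order all_algebra.
From mathcomp Require Import all_classical all_reals all_analysis.

Set Implicit Arguments.
Unset Strict Implicit.
Unset Printing Implicit Defensive.
Import Order.TTheory GRing.Theory Num.Theory.
Import numFieldNormedType.Exports.

Local Open Scope classical_set_scope.
Local Open Scope ring_scope.

Section Independence.
Context (d : measure_display) (Omega : measurableType d) (R : realType).
Variable P : probability Omega R.

Definition mutually_independent (I : eqType) (D : {pred I})
    (X : I -> {RV P >-> R}) : Prop :=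
  forall (s : seq I) (A : I -> set R),
    uniq s -> {subset s <= D} -> (forall i, measurable (A i)) ->
    P [set w | forall i, i \in s -> A i (X i w)] =
    (\big[*%E/1%E]_(i <- s) P (X i @^-1` A i))%E.

End Independence.

Section MultivariateNormal.
Context (R : realType).

(* Iterated one-dimensional Lebesgue integrals; by Tonelli, this is the integral
   against m-dimensional Lebesgue measure when f is nonnegative and measurable. *)
Fixpoint integral_tuple (m : nat) : (m.-tuple R -> \bar R) -> \bar R :=
  match m return (m.-tuple R -> \bar R) -> \bar R with
  | 0 => fun f => f [tuple]
  | m'.+1 => fun f =>
      (\int[@lebesgue_measure R]_y
         integral_tuple (fun ys : m'.-tuple R => f [tuple of y :: ys]))%E
  end.

(* The density of the centered normal law on R^m whose covariance matrix S is
   positive definite; it is not meaningful for a singular S. *)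
Definition mvnormal_pdf (m : nat) (S : 'M[R]_m) (y : 'rV[R]_m) : R :=
  expR (- (y *m invmx S *m y^T) 0 0 / 2) / Num.sqrt ((2 * pi) ^+ m * \det S).

Definition mvnormal_cdf (m : nat) (a : 'rV[\bar R]_m) (S : 'M[R]_m) : \bar R :=
  integral_tuple (fun ys : m.-tuple R =>
    if [forall l, ((tnth ys l)%:E <= a ord0 l)%E]
    then (mvnormal_pdf S (\row_l tnth ys l))%:E else 0%E).

End MultivariateNormal.

Section Model.
Context (d : measure_display) (Omega : measurableType d) (R : realType).
Variable P : probability Omega R.
Variables (theta K sigma dt : R) (N : nat) (h : nat -> R).
(* [eps i] is the innovation at time [i * dt]; [eps 0] is never used. *)
Variable eps : nat -> {RV P >-> R}.

Definition grid (n : nat) : R := n%:R * dt.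

Definition price (n i : nat) (x : R) (w : Omega) : R :=
  theta + (x - theta) * (1 - dt * K) ^+ (i - n)
  + sigma * \sum_(0 <= j < i - n) (1 - dt * K) ^+ j * eps (i - j) w.

Definition holding_cost (n : nat) : R := dt * \sum_(n <= i < N) h i.

Fixpoint value_steps (k n : nat) (x : R) : R :=
  if k is k'.+1 then
    Num.min (fine 'E_P[fun w => value_steps k' n.+1 (price n n.+1 x w)])
            (x + holding_cost n)
  else x.

Definition value (n : nat) (x : R) : R := value_steps (N - n) n x.

Definition continuation_value (n : nat) (x : R) : R :=
  fine 'E_P[fun w => value n.+1 (price n n.+1 x w)].

Lemma value_last (x : R) : value N x = x.
Proof. by rewrite /value subnn. Qed.

Lemma value_lt (n : nat) (x : R) : (n < N)%N ->
  value n x = Num.min (continuation_value n x) (x + holding_cost n).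
Proof. by move=> nN; rewrite /value -subnSK. Qed.

Definition is_threshold (b : nat -> \bar R) : Prop :=
  (forall n, (n < N)%N ->
     exists2 y : R, b n = y%:E & continuation_value n y = y + holding_cost n)
  /\ b N = +oo%E.

Definition crossing_time (b : nat -> \bar R) (n : nat) (x : R) (w : Omega) : R :=
  inf [set grid i | i in
    [set i : nat | [/\ (i <= N)%N, grid n < grid i
                     & ((price n i x w)%:E <= b i)%E]]].

Definition price_mean (n i : nat) (x : R) : R :=
  theta + (x - theta) * (1 - dt * K) ^+ (i - n).

Definition price_var (n i : nat) : R :=
  dt * sigma ^+ 2 *
  ((1 - (1 - dt * K) ^+ (2 * (i - n))) / (1 - (1 - dt * K) ^+ 2)).

Definition price_sd (n i : nat) : R := Num.sqrt (price_var n i).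

Definition std_price (n i : nat) (x : R) (w : Omega) : R :=
  (price n i x w - price_mean n i x) / price_sd n i.

(* Coordinate [l < i - n] of a vector or matrix stands for grid index n + l + 1. *)
Definition std_cov (n i : nat) (x : R) : 'M[R]_(i - n) :=
  \matrix_(l, k) fine (covariance P (std_price n (n + l.+1) x)
                                    (std_price n (n + k.+1) x)).

Definition std_threshold (b : nat -> \bar R) (n l : nat) (x : R) : \bar R :=
  ((b l - (price_mean n l x)%:E) * ((price_sd n l)^-1)%:E)%E.

Definition std_thresholds (b : nat -> \bar R) (n i : nat) (x : R) :
    'rV[\bar R]_(i - n) :=
  \row_l std_threshold b n (n + l.+1) x.

Definition std_thresholds_hat (b : nat -> \bar R) (n i : nat) (x : R) :
    'rV[\bar R]_(i - n) :=
  \row_l (if (n + l.+1 == i)%N then -oo%E else std_threshold b n (n + l.+1) x).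

End Model.

(* Main.v *)
Require Import Defs.
From HB Require Import structures.
From mathcomp Require Import all_boot all_order all_algebra.
From mathcomp Require Import all_classical all_reals all_analysis.
From mathcomp Require Import measurable_realfun zify ring lra.

Set Implicit Arguments.
Unset Strict Implicit.
Unset Printing Implicit Defensive.
Import Order.TTheory GRing.Theory Num.Theory.
Import numFieldNormedType.Exports.

Local Open Scope classical_set_scope.
Local Open Scope ring_scope.

(** The prices minus their means are linear combinations of the innovations with
    a lower triangular coefficient matrix A with nonzero diagonal.  The iterated
    integrals against the product density of the innovations therefore
    transform, one variable at a time, into iterated integrals against the
    centered normal density of covariance dt A A^T, and this matrix is Sigma.
    Since b(t_N) is infinite, the crossing time is t_i exactly when the price is
    above the threshold at t_{n+1}, ..., t_{i-1} but not at t_i: a difference of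
    two nested events, each of which says that -Z lies strictly below
    the negated standardized thresholds.  Strict and weak inequalities have the
    same integral, as they differ on finitely many hyperplanes. *)

(** * Iterated integrals: positivity, measurability, null hyperplanes *)

Section IntegralTuple.
Context (R : realType).
(* Lebesgue measure lives on this alias of R, whose display differs from that of
   the default measurable structure of R, used by random variables. *)
Local Notation RT := (measurableTypeR R).
Local Notation mu := (@lebesgue_measure R).
Local Open Scope ereal_scope.

Lemma integral_tuple_ge0 m (f : m.-tuple R -> \bar R) :
  (forall ys, 0 <= f ys) -> 0 <= integral_tuple f.
Proof.
elim: m f => [|m IH] f f0 /=; first exact: f0.
by apply: integral_ge0 => y _; apply: IH.
Qed.

(** The parameter space [T] is arbitrary so that the induction can absorb the outermost variable:
    the inner integral is measurable on [T * RT], and Tonelli integrates out the last factor. *)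
Lemma measurable_integral_tuple d (T : measurableType d) m
    (f : T -> m.-tuple R -> \bar R) :
  measurable_fun setT (fun p : T * m.-tuple RT => f p.1 p.2) ->
  (forall t ys, 0 <= f t ys) ->
  measurable_fun setT (fun t => integral_tuple (f t)).
Proof.
elim: m d T f => [|m IH] d T f mf f0 /=.
  apply: (@measurableT_comp _ _ _ _ _ _
    (fun p : T * 0.-tuple RT => f p.1 p.2) _ (fun t => (t, [tuple]))) => //.
pose g (p : T * RT) := integral_tuple (fun ys => f p.1 [tuple of p.2 :: ys]).
apply: (@measurable_fun_fubini_tonelli_F _ _ T RT R mu g) => [|p]; last first.
  by apply: integral_tuple_ge0.
apply: (IH _ (T * RT)%type (fun p ys => f p.1 [tuple of p.2 :: ys])) => //.
apply: (@measurableT_comp _ _ _ _ _ _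
  (fun p : T * m.+1.-tuple RT => f p.1 p.2) _
  (fun q : T * RT * m.-tuple RT => (q.1.1, [tuple of q.1.2 :: q.2]))) => //.
apply/measurable_fun_pair.
  exact: measurableT_comp.
apply: measurable_cons => //; exact: measurableT_comp.
Qed.

Lemma measurable_tuple_section m (f : m.+1.-tuple R -> \bar R) y :
  measurable_fun [set: m.+1.-tuple RT] f ->
  measurable_fun [set: m.-tuple RT] (fun ys => f [tuple of y :: ys]).
Proof.
move=> mf; apply: (@measurableT_comp _ _ _ _ _ _ f _
  (fun ys : m.-tuple RT => [tuple of y :: ys])) => //.
exact: measurable_cons.
Qed.

Lemma measurable_integral_tuple_cons m (f : m.+1.-tuple R -> \bar R) :
  measurable_fun [set: m.+1.-tuple RT] f -> (forall ys, 0 <= f ys) ->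
  measurable_fun [set: RT]
    (fun y : RT => integral_tuple (fun ys => f [tuple of y :: ys])).
Proof.
move=> mf f0.
apply: (@measurable_integral_tuple _ RT _ (fun y ys => f [tuple of y :: ys])) => //.
apply: (@measurableT_comp _ _ _ _ _ _ f _
  (fun q : RT * m.-tuple RT => [tuple of q.1 :: q.2])) => //.
exact: measurable_cons.
Qed.

Lemma integral_tupleZl m (c : R) (f : m.-tuple R -> \bar R) :
  measurable_fun [set: m.-tuple RT] f -> (forall ys, 0 <= f ys) ->
  (0 <= c)%R ->
  integral_tuple (fun ys => c%:E * f ys) = c%:E * integral_tuple f.
Proof.
elim: m f => [//|m IH] f mf f0 c0 /=.
rewrite -ge0_integralZl//; first last.
  by move=> y _; apply: integral_tuple_ge0.
  exact: measurable_integral_tuple_cons.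
by apply: eq_integral => y _; rewrite IH//; exact: measurable_tuple_section.
Qed.

(** A hyperplane orthogonal to an axis meets the outermost variable in at most one value, which is
    Lebesgue null; for every other value the induction hypothesis handles the section. *)
Lemma integral_tuple_eq_off_hyperplanes m (r : 'I_m -> \bar R)
    (f g : m.-tuple R -> \bar R) :
  measurable_fun [set: m.-tuple RT] f -> (forall ys, 0 <= f ys) ->
  measurable_fun [set: m.-tuple RT] g -> (forall ys, 0 <= g ys) ->
  (forall ys, (forall l, (tnth ys l)%:E != r l) -> f ys = g ys) ->
  integral_tuple f = integral_tuple g.
Proof.
elim: m r f g => [|m IH] r f g mf f0 mg g0 fg /=; first by apply: fg => -[].
apply: ae_eq_integral => //; try exact: measurable_integral_tuple_cons.
change (mu.-negligible (~` [set y : RT | setT y ->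
  integral_tuple (fun ys => f [tuple of y :: ys]) =
  integral_tuple (fun ys => g [tuple of y :: ys])])).
(* If [r ord0] is infinite, [fine] yields 0; the excluded set is still a single point. *)
apply: (@negligibleS _ RT _ mu [set fine (r ord0)]); last first.
  by apply/negligibleP => //; exact: lebesgue_measure_set1.
move=> y /= H; apply: contrapT => yr; apply: H.
move=> _; apply: (IH (fun l => r (lift ord0 l))) => //.
- exact: measurable_tuple_section.
- exact: measurable_tuple_section.
move=> ys ysr; apply: fg => l; case: (unliftP ord0 l) => [l' ->|->].
  by rewrite tnthS.
by rewrite tnth0; apply/eqP => e; apply: yr; rewrite -e.
Qed.

End IntegralTuple.

(** * Affine and triangular changes of variables *)

Section AffineSubstitution.
Context (R : realType).
Local Notation RT := (measurableTypeR R).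
Local Notation mu := (@lebesgue_measure R).

Lemma measurable_affine (a c : R) :
  measurable_fun [set: RT] (fun y : RT => a * y + c : RT).
Proof. by apply: measurable_funD => //; exact: measurable_funM. Qed.

(** By uniqueness of Lebesgue measure it suffices to compare the two sides on intervals []u, v]],
    whose preimages are intervals of length [(v - u) / |a|]. *)
Lemma lebesgue_measure_affine (a c : R) (A : set RT) : a != 0 -> measurable A ->
  (`|a|%:E * pushforward mu (fun y : RT => (a * y + c)%R : RT) A = mu A)%E.
Proof.
move=> a0 mA; pose k : {nonneg R} := NngNum (normr_ge0 a).
pose phi (y : RT) : RT := a * y + c.
(* The pushforward is packaged as a measure known only by its values, so that it can be scaled by
   [|a|]. *)
have [m mE] : exists m : {measure set RT -> \bar R},
    m = pushforward mu phi :> (set RT -> \bar R).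
  have mphi : measurable_fun [set: RT] phi by exact: measurable_affine.
  by unshelve eexists (pushforward mu phi).
rewrite -mE; symmetry.
apply: (@lebesgue_measure_unique R (mscale k m)) => //= _ [[u v]] _ <-.
rewrite /mscale mE.
rewrite /pushforward /= lebesgue_measure_itv /=.
case: (ltgtP a 0) a0 => // a0 _.
  (* A negative slope reverses the order: the endpoints swap, and so does the closed side. *)
  have -> : phi @^-1` `]u, v] = `[(v - c) / a, (u - c) / a[%classic.
    apply/seteqP; split=> y /=; rewrite /phi !in_itv /= ler_ndivrMr// ltr_ndivlMr//;
      by move=> /andP[h1 h2]; apply/andP; split; lra.
  rewrite lebesgue_measure_itv /= !lte_fin ltr_ndivlMr// divfK ?lt_eqF//.
  rewrite ltrD2r; case: ifP => _; last by rewrite mule0.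
  rewrite -!EFinB -EFinM ltr0_norm//; congr (_%:E); field.
  by rewrite lt_eqF.
have -> : phi @^-1` `]u, v] = `](u - c) / a, (v - c) / a]%classic.
  apply/seteqP; split=> y /=; rewrite /phi !in_itv /= ler_pdivlMr// ltr_pdivrMr//;
    by move=> /andP[h1 h2]; apply/andP; split; lra.
rewrite lebesgue_measure_itv /= !lte_fin ltr_pdivrMr// divfK ?gt_eqF//.
rewrite ltrD2r; case: ifP => _; last by rewrite mule0.
rewrite -!EFinB -EFinM gtr0_norm//; congr (_%:E); field.
by rewrite gt_eqF.
Qed.

Lemma integral_affine (a c : R) (f : R -> \bar R) : a != 0 ->
  measurable_fun [set: RT] f -> (forall y, 0 <= f y)%E ->
  (\int[mu]_y f (a * y + c)%R = `|a|^-1%:E * \int[mu]_y f y)%E.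
Proof.
move=> a0 mf f0; pose k : {nonneg R} := NngNum (normr_ge0 a).
pose mphi := measurable_affine a c.
have -> : (\int[mu]_y f y = `|a|%:E * \int[mu]_y f (a * y + c)%R)%E.
  have /= <- := ge0_integral_pushforward mphi mu measurableT mf (fun y _ => f0 y).
  rewrite -[`|a|]/(k%:num) -ge0_integral_mscale//.
  by apply: eq_measure_integral => A mA _; rewrite /= -(lebesgue_measure_affine c a0 mA).
by rewrite muleA -EFinM mulVf ?normr_eq0// mul1e.
Qed.

(** The shift [c] is there for induction on [m]: once the first coordinate is fixed, its
    contribution to the later rows becomes part of their shift. Entries of [a] above the diagonal
    are never read. *)
Definition triangular_map m (c : nat -> R) (a : nat -> nat -> R)
    (ys : m.-tuple R) : m.-tuple R :=
  [tuple c l + \sum_(j < l.+1) a l j * nth 0 ys j | l < m].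

Lemma triangular_map_cons m c a y (ys : m.-tuple R) :
  triangular_map c a [tuple of y :: ys] =
  [tuple of c 0%N + a 0%N 0%N * y
    :: triangular_map (fun l => c l.+1 + a l.+1 0%N * y)
         (fun l j => a l.+1 j.+1) ys].
Proof.
apply: eq_from_tnth => l; rewrite tnth_mktuple.
case: (unliftP ord0 l) => [l' ->|->].
  by rewrite tnthS tnth_mktuple /= /bump add1n big_ord_recl /= addrA.
by rewrite tnth0 /= big_ord_recl big_ord0 addr0.
Qed.

Lemma measurable_triangular_map m c a :
  measurable_fun [set: m.-tuple RT] (triangular_map c a : m.-tuple RT -> m.-tuple RT).
Proof.
apply/measurable_fun_tnthP => l.
rewrite [X in measurable_fun _ X](_ : _ =
  (fun ys : m.-tuple RT => c l + \sum_(j < l.+1) a l j * nth 0 ys j)); last first.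
  by apply/funext => ys /=; rewrite tnth_mktuple.
apply: measurable_funD => //; apply: measurable_sum => j.
apply: measurable_funM => //.
have jm : (j < m)%N by exact: leq_ltn_trans (leq_ord j) (ltn_ord l).
rewrite [X in measurable_fun _ X](_ : _ =
  (fun ys : m.-tuple RT => tnth ys (Ordinal jm))); first exact: measurable_tnth.
by apply/funext => ys; rewrite (tnth_nth 0).
Qed.

(** For fixed outer variables each new coordinate is an affine function of one variable, with slope
    the diagonal entry, so [integral_affine] applies one variable at a time and the Jacobian is the
    product of the diagonal. *)
Lemma integral_tuple_triangular m (c : nat -> R) (a : nat -> nat -> R)
    (f : m.-tuple R -> \bar R) :
  (forall l, (l < m)%N -> a l l != 0) ->
  measurable_fun [set: m.-tuple RT] f -> (forall ys, 0 <= f ys)%E ->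
  integral_tuple (fun ys => f (triangular_map c a ys)) =
  ((\prod_(l < m) `|a l l|^-1)%:E * integral_tuple f)%E.
Proof.
elim: m c a f => [|m IH] c a f a0 mf f0.
  by rewrite /= big_ord0 mul1e; congr f; apply: eq_from_tnth => -[].
pose G (y : RT) := integral_tuple (fun ys => f [tuple of y :: ys]).
have mG : measurable_fun [set: RT] G by exact: measurable_integral_tuple_cons.
have G0 y : (0 <= G y)%E by exact: integral_tuple_ge0.
rewrite big_ord_recl mulrC EFinM -muleA.
rewrite -[integral_tuple f]/(\int[mu]_y G y)%E -(integral_affine (c 0%N)) ?a0//.
rewrite -ge0_integralZl//; first last.
- by rewrite lee_fin; apply: prodr_ge0 => l _; rewrite invr_ge0.
- apply: (@measurableT_comp _ _ _ _ _ _ G) => //; exact: measurable_affine.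
apply: eq_integral => y _ /=.
pose g (ys : m.-tuple R) := f [tuple of a 0%N 0%N * (y : R) + c 0%N :: ys].
rewrite -[RHS](IH (fun l => c l.+1 + a l.+1 0%N * (y : R))
  (fun l j => a l.+1 j.+1) g) => [|l lm||ys].
- congr integral_tuple; apply/funext => ys.
  by rewrite /g addrC -(triangular_map_cons c a (y : R)).
- by rewrite a0.
- exact: measurable_tuple_section.
- exact: f0.
Qed.

End AffineSubstitution.

(** * Integration against the one-dimensional normal law *)

Lemma integral_normal_prob (R : realType) (m s : R) (f : R -> \bar R) :
  measurable_fun [set: measurableTypeR R] f -> (forall x, 0 <= f x)%E ->
  (\int[normal_prob m s]_x f x =
   \int[@lebesgue_measure R]_x (f x * (normal_pdf m s x)%:E))%E.
Proof.
move=> mf f0; have dom := normal_prob_dominates m s.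
(* The Radon-Nikodym derivative and [normal_pdf] have the same integral over every measurable set,
   hence agree almost everywhere. *)
rewrite -(Radon_Nikodym_SigmaFinite.change_of_variables dom f0 measurableT mf).
apply: ae_eq_integral => //.
- apply: emeasurable_funM => //; apply: measurable_int.
  exact: Radon_Nikodym_SigmaFinite.f_integrable.
- apply: emeasurable_funM => //.
  by apply/measurable_EFinP; exact: measurable_normal_pdf.
apply: ae_eqe_mul2l; apply: integral_ae_eq => //.
- exact: Radon_Nikodym_SigmaFinite.f_integrable.
- by apply/measurable_EFinP; exact: measurable_normal_pdf.
by move=> E _ mE; rewrite -Radon_Nikodym_SigmaFinite.f_integral.
Qed.

(** * Independence of one variable from the tuple of the others *)

Section IndependentNormals.
Context (R : realType).
Local Notation RT := (measurableTypeR R).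
Local Notation mu := (@lebesgue_measure R).

(** Boxes are closed under intersection and generate the product sigma-algebra, so finite measures
    that agree on them are equal. *)
Lemma measure_tuple_unique m (m1 m2 : {measure set (m.-tuple RT) -> \bar R}) :
  (m1 setT < +oo)%E ->
  (forall A : nat -> set RT, (forall l, measurable (A l)) ->
    m1 [set ys : m.-tuple RT | forall l : 'I_m, A l (tnth ys l)] =
    m2 [set ys : m.-tuple RT | forall l : 'I_m, A l (tnth ys l)]) ->
  forall B, measurable B -> m1 B = m2 B.
Proof.
move=> m1oo m12 B mB.
pose G : set (set (m.-tuple RT)) := [set C | exists2 A : nat -> set RT,
  forall l, measurable (A l) &
  C = [set ys : m.-tuple RT | forall l : 'I_m, A l (tnth ys l)]].
have GT : G setT.
  by exists (fun=> setT) => //; apply/seteqP; split.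
apply: (measure_unique G (fun=> setT)) => //.
- apply/seteqP; split; last first.
    apply: smallest_sub; first exact: sigma_algebra_measurable.
    move=> _ [A mA ->].
    have -> : [set ys : m.-tuple RT | forall l : 'I_m, A l (tnth ys l)] =
        \bigcap_(l in [set: 'I_m]) ((fun ys => tnth ys l) @^-1` A l).
      by apply/seteqP; split=> ys /= H l; [move=> _; exact: H|exact: (H l I)].
    apply: fin_bigcap_measurable => // l _.
    by rewrite -[X in measurable X]setTI; exact: measurable_tnth.
  apply: smallest_sub; first exact: smallest_sigma_algebra.
  move=> C /=; rewrite -bigcup_seq /= => -[l _ [A mA <-]].
  (* A cylinder over one coordinate is a box whose other sides are the whole line. *)
  apply: sub_sigma_algebra; exists (fun j => if j == l :> nat then A else setT).
    by move=> j; case: ifP.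
  rewrite setTI; apply/seteqP; split => ys /=.
    by move=> Al j; case: eqP => // /val_inj ->.
  by move=> /(_ l); rewrite eqxx.
- move=> _ _ [A mA ->] [A' mA' ->]; exists (fun l => A l `&` A' l).
    by move=> l; exact: measurableI.
  apply/seteqP; split=> ys /=; first by move=> [H1 H2] l; split.
  by move=> H; split=> l; case: (H l).
- by apply/seteqP; split => // ys _; exists 0%N.
- by move=> _ [A mA ->]; exact: m12.
Qed.

Context (d : measure_display) (Omega : measurableType d) (P : probability Omega R).

(** The product rule is stated for all [m] indices at once; taking some [A l] to be [setT] gives it
    for subfamilies. *)
Definition independent_upto (m : nat) (X : nat -> {RV P >-> R}) : Prop :=
  forall A : nat -> set R, (forall l, measurable (A l)) ->
    P [set w | forall l, (l < m)%N -> A l (X l w)] =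
    (\prod_(l < m) P (X l @^-1` A l))%E.

Lemma independent_upto_behead m (X : nat -> {RV P >-> R}) :
  independent_upto m.+1 X -> independent_upto m (fun l => X l.+1).
Proof.
move=> ind A mA; pose A' l : set R := if l is l'.+1 then A l' else setT.
have mA' l : measurable (A' l) by case: l => [|l]; [exact: measurableT|exact: mA].
have := ind A' mA'; rewrite big_ord_recl /= preimage_setT probability_setT mul1e.
move=> <-.
congr (P _); apply/seteqP; split => w /= H l lm; last exact: (H l.+1).
by case: l lm => // l; exact: H.
Qed.

Lemma measurable_tuple_of (m : nat) (X : nat -> {RV P >-> R}) :
  measurable_fun [set: Omega]
    (fun w => [tuple X l w | l < m] : m.-tuple RT).
Proof.
apply/measurable_fun_tnthP => l.
apply: (eq_measurable_fun (X l)) => // w _ /=.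
by rewrite tnth_mktuple.
Qed.

(** With [A] fixed, both sides are finite measures in [B]: the law of the remaining variables
    restricted to the event on [X 0], and that law scaled by the probability of this event. On boxes
    their equality is the product rule. *)
Lemma independent_upto_cons m (X : nat -> {RV P >-> R}) (A : set R)
    (B : set (m.-tuple RT)) :
  independent_upto m.+1 X -> measurable A -> measurable B ->
  P (X 0%N @^-1` A `&` [set w | B [tuple X l.+1 w | l < m]]) =
  (P (X 0%N @^-1` A) * P [set w | B [tuple X l.+1 w | l < m]])%E.
Proof.
move=> ind mA mB.
have mXA : measurable (X 0%N @^-1` A) by exact: measurable_funPTI.
have mY := @measurable_tuple_of m (fun l => X l.+1).
have k0 : 0 <= fine (P (X 0%N @^-1` A)) by rewrite fine_ge0.
pose k : {nonneg R} := NngNum k0.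
have kE : k%:num%:E = P (X 0%N @^-1` A) by rewrite /= fineK// fin_num_measure.
(* The instances are named because they depend on the proof mY. *)
pose PY := measure_function_pushforward__canonical__measure_function_Measure P mY.
pose PAY := measure_function_pushforward__canonical__measure_function_Measure
  (mrestr P mXA) mY.
rewrite setIC -kE -[LHS]/(PAY B) -[RHS]/(mscale k PY B).
apply: measure_tuple_unique => // [|A' mA'].
  rewrite /= /pushforward /mrestr preimage_setT setTI.
  by rewrite (le_lt_trans (probability_le1 P mXA))// ltry.
rewrite /= /mscale /= /pushforward /mrestr /=.
pose A'' l : set R := if l is l'.+1 then A' l' else A.
have mA'' l : measurable (A'' l) by case: l => [|l]; [exact: mA|exact: mA'].
have := ind A'' mA''; rewrite big_ord_recl /=.
rewrite -(independent_upto_behead ind)// fineK ?fin_num_measure//.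
set L := P _ => H; transitivity L.
  congr (P _); apply/seteqP; split => w /=.
    move=> [H1 H2] [|l] //= lm.
    by have := H1 (Ordinal (lm : (l < m)%N)); rewrite tnth_mktuple.
  move=> H1; split; last exact: (H1 0%N (ltn0Sn m)).
  by move=> l; rewrite tnth_mktuple; exact: (H1 l.+1 (ltn_ord l)).
rewrite H.
congr (_ * P _)%E; apply/seteqP; split => w /= H1 l.
  by rewrite tnth_mktuple; exact: H1 (ltn_ord l).
by move=> lm; have := H1 (Ordinal lm); rewrite tnth_mktuple.
Qed.

End IndependentNormals.

(** * Expectations of functions of independent normals as iterated integrals *)

Section IndependentNormalsIntegral.
Context (R : realType) (d : measure_display) (Omega : measurableType d).
Variable P : probability Omega R.
Local Notation RT := (measurableTypeR R).

Lemma measurable_prod_normal_pdf m (s : R) :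
  measurable_fun [set: m.-tuple RT]
    (fun ys : m.-tuple RT => (\prod_(l < m) normal_pdf 0 s (tnth ys l))%:E).
Proof.
apply/measurable_EFinP; apply: measurable_prod => l _.
apply: (@measurableT_comp _ _ _ _ _ _ (normal_pdf 0 s) _
  (fun ys : m.-tuple RT => tnth ys l)); first exact: measurable_normal_pdf.
exact: measurable_tnth.
Qed.

(** Induction on [m]: the joint law of [X 0] and the tuple of the others is a product measure,
    Tonelli splits it, the outer integral acquires its density, and the inner one is the case of one
    variable fewer. *)
Lemma independent_normals_integral m (s : R) (X : nat -> {RV P >-> R})
    (f : m.-tuple R -> \bar R) :
  independent_upto m X ->
  (forall l, (l < m)%N -> forall A : set R, measurable A ->
     distribution P (X l) A = normal_prob 0 s A) ->
  measurable_fun [set: m.-tuple RT] f -> (forall ys, 0 <= f ys)%E ->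
  (\int[P]_w f [tuple X l w | l < m] =
   integral_tuple (fun ys => f ys * (\prod_(l < m) normal_pdf 0 s (tnth ys l))%:E))%E.
Proof.
elim: m X f => [|m IH] X f ind nX mf f0.
  rewrite /= big_ord0 mule1 (eq_integral (fun=> f [tuple])).
    rewrite integral_cst// -[RHS]mule1; congr (_ * _)%E; exact: probability_setT.
  by move=> w _; congr f; apply: eq_from_tnth => -[].
have mY := @measurable_tuple_of _ _ _ P m (fun l => X l.+1).
pose Y w : m.-tuple RT := [tuple X l.+1 w | l < m].
pose mixY := isMeasurableFun.Build _ _ _ _ Y mY.
pose Yrv : {mfun Omega >-> m.-tuple RT} := HB.pack Y mixY.
pose F (p : RT * m.-tuple RT) := f [tuple of p.1 :: p.2].
have mF : measurable_fun setT F.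
  apply: (@measurableT_comp _ _ _ _ _ _ f _
    (fun q : RT * m.-tuple RT => [tuple of q.1 :: q.2])) => //.
  exact: measurable_cons.
have mZ : measurable_fun setT (fun w => (X 0%N w : RT, Y w)).
  by apply: measurable_fun_pair; [exact: (measurable_funPT (X 0%N))|exact: mY].
have F0 p : (0 <= F p)%E by exact: f0.
transitivity (\int[P]_w F (X 0%N w, Y w))%E.
  apply: eq_integral => w _; congr f; apply: eq_from_tnth => l.
  rewrite tnth_mktuple; case: (unliftP ord0 l) => [l' ->|->].
    by rewrite tnthS tnth_mktuple.
  by rewrite tnth0.
have /= <- := ge0_integral_pushforward mZ P measurableT mF (fun y _ => F0 y).
(* The product measure is determined by rectangles, where [independent_upto_cons] applies. *)
transitivity (\int[normal_prob 0%R s \x distribution P Yrv]_p F p)%E.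
  apply: eq_measure_integral => C mC _; symmetry.
  apply: product_measure_unique => // A B mA mB.
  transitivity (P (X 0%N @^-1` A) * P [set w | B (Y w)])%E.
    exact: independent_upto_cons.
  by congr (_ * _)%E; exact: nX.
rewrite fubini_tonelli1// integral_normal_prob//; last 2 first.
  exact: measurable_fun_fubini_tonelli_F.
  by move=> x; apply: integral_ge0.
apply: eq_integral => x _.
rewrite /fubini_F ge0_integral_distribution//; last exact: measurable_tuple_section.
rewrite (IH (fun l => X l.+1) (fun ys => f [tuple of x :: ys])); first last.
- by [].
- exact: measurable_tuple_section.
- by move=> l lm A mA; apply: nX.
- exact: independent_upto_behead.
rewrite muleC -integral_tupleZl; first last.
- exact: normal_pdf_ge0.
- move=> ys; rewrite mule_ge0// lee_fin; apply: prodr_ge0 => l _.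
  exact: normal_pdf_ge0.
- apply: emeasurable_funM; last exact: measurable_prod_normal_pdf.
  exact: measurable_tuple_section.
congr integral_tuple; apply/funext => ys.
rewrite muleCA -EFinM big_ord_recl tnth0; congr (_ * (_ * _)%:E)%E.
by apply: eq_bigr => l _; rewrite tnthS.
Qed.

End IndependentNormalsIntegral.

(** * The multivariate normal density under a triangular map *)

Section TriangularNormal.
Context (R : realType).
Local Notation RT := (measurableTypeR R).

Definition lower_mx m (a : nat -> nat -> R) : 'M[R]_m :=
  \matrix_(l, j) (if (j <= l)%N then a l j else 0).

Lemma det_lower_mx m a : \det (lower_mx m a) = \prod_(l < m) a l l.
Proof.
rewrite det_trig; first by apply: eq_bigr => l _; rewrite mxE leqnn.
by apply/is_trig_mxP => l j lj; rewrite mxE leqNgt lj.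
Qed.

Lemma row_triangular_map m a (ys : m.-tuple R) :
  \row_l tnth (triangular_map (fun=> 0) a ys) l =
  (\row_l tnth ys l) *m (lower_mx m a)^T.
Proof.
apply/rowP => l; rewrite !mxE tnth_mktuple add0r.
rewrite (big_ord_widen _ (fun j => a l j * nth 0 ys j) (ltn_ord l)) big_mkcond /=.
apply: eq_bigr => j _; rewrite !mxE ltnS mulrC (tnth_nth 0).
by case: ifP => _; rewrite ?mul0r ?mulr0// mulrC.
Qed.

(** With [S] the scaled Gram matrix of [M], the matrix [M^T *m invmx S *m M] is a multiple of the
    identity, so the exponent of the correlated density becomes that of independent coordinates. *)
Lemma quadratic_form_gram m (M : 'M[R]_m) (s : R) (u : 'rV[R]_m) :
  s != 0 -> M \in unitmx ->
  (u *m M^T) *m invmx (s ^+ 2 *: (M *m M^T)) *m (u *m M^T)^T =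
  (s ^+ 2)^-1 *: (u *m u^T).
Proof.
move=> s0 Mu; set S := s ^+ 2 *: _.
have Su : S \in unitmx.
  by rewrite unitmxZ ?unitmx_mul ?unitmx_tr ?Mu// unitfE expf_neq0.
transitivity (u *m (M^T *m invmx S *m M) *m u^T).
  by rewrite trmx_mul trmxK !mulmxA.
suff -> : M^T *m invmx S *m M = (s ^+ 2)^-1 *: 1%:M.
  by rewrite -scalemxAr mulmx1 -scalemxAl.
(* Multiplying by [M] on the left makes [M *m M^T], a multiple of [S], appear next to [invmx S]. *)
apply: (can_inj (mulKmx Mu)); rewrite !mulmxA -scalemxAr mulmx1.
have -> : M *m M^T = (s ^+ 2)^-1 *: S by rewrite scalerA mulVf ?scale1r// expf_neq0.
by rewrite -2!scalemxAl mulmxV// mul1mx.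
Qed.

Lemma prod_normal_pdf m (s : R) (ys : m.-tuple R) : 0 < s ->
  let u := \row_l tnth ys l in
  \prod_(l < m) normal_pdf 0 s (tnth ys l) =
  expR (- ((s ^+ 2)^-1 *: (u *m u^T)) 0 0 / 2) /
    Num.sqrt ((2 * pi * s ^+ 2) ^+ m).
Proof.
move=> s0 u; rewrite (eq_bigr (fun l =>
  normal_peak s * expR (- (s ^+ 2)^-1 / 2 * tnth ys l ^+ 2))); last first.
  move=> l _; rewrite normal_pdfE ?gt_eqF// /normal_fun; congr (_ * expR _).
  by field; rewrite gt_eqF.
rewrite big_split /= prodr_const card_ord mulrC; congr (_ * _).
  rewrite -expR_sum -mulr_sumr; congr expR.
  have -> : \sum_(l < m) tnth ys l ^+ 2 = (u *m u^T) 0 0.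
    by rewrite mxE; apply: eq_bigr => l _; rewrite !mxE expr2.
  by rewrite [in RHS]mxE; ring.
rewrite /normal_peak exprVn; congr (_^-1).
have -> : s ^+ 2 * pi *+ 2 = 2 * pi * s ^+ 2 by ring.
have c0 : 0 <= 2 * pi * s ^+ 2 by rewrite mulr_ge0 ?sqr_ge0 ?mulr_ge0 ?pi_ge0.
elim: m {ys u} => [|m IH]; first by rewrite !expr0 sqrtr1.
by rewrite (exprS (Num.sqrt _)) (exprS (2 * pi * s ^+ 2)) IH -sqrtrM.
Qed.

(** The exponents agree by [quadratic_form_gram]. The square root of the determinant of the
    covariance contributes [|det A|], the product of the [|a l l|], which the factor in front
    cancels. *)
Lemma mvnormal_pdf_triangular m (s : R) a (ys : m.-tuple R) :
  0 < s -> (forall l, (l < m)%N -> a l l != 0) ->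
  (\prod_(l < m) `|a l l|) *
    mvnormal_pdf (s ^+ 2 *: (lower_mx m a *m (lower_mx m a)^T))
      (\row_l tnth (triangular_map (fun=> 0) a ys) l) =
  \prod_(l < m) normal_pdf 0 s (tnth ys l).
Proof.
move=> s0 a0; have pa0 : \prod_(l < m) a l l != 0.
  by apply/prodf_neq0 => l _; exact: a0.
rewrite prod_normal_pdf// /mvnormal_pdf row_triangular_map quadratic_form_gram.
- rewrite detZ det_mulmx det_tr det_lower_mx -normr_prod mulrCA; congr (_ * _).
  rewrite -expr2 mulrA sqrtrM; last first.
    by rewrite !(mulr_ge0, exprn_ge0, pi_ge0)// ltW.
  rewrite sqrtr_sqr invfM mulrCA divff ?mulr1 ?normr_eq0//.
  by rewrite -exprMn.
- by rewrite gt_eqF.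
- by rewrite unitmxE det_lower_mx unitfE.
Qed.

Lemma measurable_mvnormal_pdf m (S : 'M[R]_m) :
  measurable_fun [set: m.-tuple RT]
    (fun ys : m.-tuple RT => (mvnormal_pdf S (\row_l tnth ys l))%:E).
Proof.
apply/measurable_EFinP; apply: measurable_funM => //.
apply: measurableT_comp => //; apply: measurable_funM => //.
apply: measurable_funN.
apply: (eq_measurable_fun (fun ys : m.-tuple RT =>
  \sum_(k < m) (\sum_(j < m) tnth ys j * invmx S j k) * tnth ys k)).
  move=> ys _; rewrite !mxE; apply: eq_bigr => k _; rewrite !mxE.
  by congr (_ * _); apply: eq_bigr => j _; rewrite !mxE.
apply: measurable_sum => k; apply: measurable_funM; last exact: measurable_tnth.
apply: measurable_sum => j; apply: measurable_funM => //; exact: measurable_tnth.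
Qed.

Lemma mvnormal_pdf_ge0 m (S : 'M[R]_m) y : 0 <= mvnormal_pdf S y.
Proof. by rewrite mulr_ge0 ?expR_ge0// invr_ge0. Qed.

Lemma measurable_box m (p : 'I_m -> R -> bool) :
  (forall l, measurable [set x : RT | p l x]) ->
  measurable_fun [set: m.-tuple RT]
    (fun ys : m.-tuple RT => [forall l, p l (tnth ys l)]).
Proof.
move=> mp; apply: (measurable_fun_bool true) => //; rewrite setTI.
have -> : (fun ys : m.-tuple RT => [forall l, p l (tnth ys l)]) @^-1` [set true] =
    \bigcap_(l in [set: 'I_m]) ((fun ys => tnth ys l) @^-1` [set x | p l x]).
  apply/seteqP; split => ys /=; first by move=> /forallP H l _; exact: H.
  by move=> H; apply/forallP => l; exact: (H l I).
apply: fin_bigcap_measurable => // l _.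
by rewrite -[X in measurable X]setTI; exact: measurable_tnth.
Qed.

End TriangularNormal.

(** * The distribution function of triangular combinations of independent normals *)

Section TriangularNormalCdf.
Context (R : realType) (d : measure_display) (Omega : measurableType d).
Variable P : probability Omega R.
Local Notation RT := (measurableTypeR R).

Lemma integral_if_one (p : Omega -> bool) : measurable_fun setT p ->
  (\int[P]_w (if p w then 1 else 0) = P [set w | p w])%E.
Proof.
move=> mp; have mA : measurable [set w | p w].
  by rewrite -[X in measurable X]setTI; exact: (mp measurableT [set true]).
rewrite -[in RHS](setIT [set w | p w]) -(@integral_indic _ _ _ P _ measurableT)//.
apply: eq_integral => w _; rewrite indicE; case: ifPn => pw.
  by rewrite mem_set.
by rewrite memNset//; exact/negP.
Qed.

Lemma measurable_lte_cst (y : \bar R) : measurable [set x : RT | (x%:E < y)%E].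
Proof. by rewrite -[X in measurable X]setTI; apply: emeasurable_fun_infty_o. Qed.

Lemma measurable_lee_cst (y : \bar R) : measurable [set x : RT | (x%:E <= y)%E].
Proof. by rewrite -[X in measurable X]setTI; apply: emeasurable_fun_infty_c. Qed.

(** The probability is an iterated integral against the product density, which is [|det A|] times
    the correlated density at the transformed point; the triangular substitution then produces the
    inverse of that factor. *)
Lemma independent_normals_cdf m (s : R) (X : nat -> {RV P >-> R})
    (a : nat -> nat -> R) (c : 'rV[\bar R]_m) :
  0 < s -> independent_upto m X ->
  (forall l, (l < m)%N -> forall A : set R, measurable A ->
     distribution P (X l) A = normal_prob 0 s A) ->
  (forall l, (l < m)%N -> a l l != 0) ->
  P [set w | [forall l : 'I_m, ((\sum_(j < l.+1) a l j * X j w)%:E < c ord0 l)%E]] =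
  mvnormal_cdf c (s ^+ 2 *: (lower_mx m a *m (lower_mx m a)^T)).
Proof.
move=> s0 ind nX a0; set S := _ *: _.
pose below (ys : m.-tuple R) := [forall l, ((tnth ys l)%:E < c ord0 l)%E].
pose T := triangular_map (fun=> 0) a : m.-tuple RT -> m.-tuple RT.
pose Y w : m.-tuple RT := [tuple X l w | l < m].
have mbelow : measurable_fun [set: m.-tuple RT] below.
  exact: (measurable_box (fun l => measurable_lte_cst (c ord0 l))).
have mT : measurable_fun [set: m.-tuple RT] T by exact: measurable_triangular_map.
have mY : measurable_fun [set: Omega] Y by exact: measurable_tuple_of.
have k0 : 0 <= \prod_(l < m) `|a l l| by apply: prodr_ge0.
pose f (ys : m.-tuple R) : \bar R := if below ys then 1%E else 0%E.
have mf : measurable_fun [set: m.-tuple RT] f by exact: measurable_fun_ifT.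
have f0 ys : (0 <= f ys)%E by rewrite /f; case: ifP.
pose g (ys : m.-tuple R) := (f ys * (mvnormal_pdf S (\row_l tnth ys l))%:E)%E.
have mg : measurable_fun [set: m.-tuple RT] g.
  by apply: emeasurable_funM => //; exact: measurable_mvnormal_pdf.
have g0 ys : (0 <= g ys)%E by rewrite mule_ge0// lee_fin mvnormal_pdf_ge0.
have mfT : measurable_fun [set: m.-tuple RT] (f \o T) by exact: (measurableT_comp mf).
transitivity (\int[P]_w f (T (Y w)))%E.
  rewrite integral_if_one; last first.
    by apply: (measurableT_comp mbelow); exact: measurableT_comp.
  congr (P _); apply/funext => w /=; congr is_true; apply: eq_forallb => l.
  rewrite tnth_mktuple add0r; congr (_%:E < _)%E; apply: eq_bigr => j _.
  have jm : (j < m)%N by exact: leq_ltn_trans (leq_ord j) (ltn_ord l).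
  by rewrite -(tnth_nth _ _ (Ordinal jm)) tnth_mktuple.
rewrite (independent_normals_integral (f := f \o T) ind nX mfT (fun ys => f0 (T ys))).
transitivity (integral_tuple (fun ys => (\prod_(l < m) `|a l l|)%:E * g (T ys)))%E.
  congr integral_tuple; apply/funext => ys.
  by rewrite -(mvnormal_pdf_triangular ys s0 a0) EFinM muleCA.
rewrite integral_tupleZl//; last exact: measurableT_comp.
rewrite (integral_tuple_triangular (fun=> 0) a0 mg g0) muleA -EFinM.
rewrite -big_split /= big1 ?mul1e; last first.
  by move=> l _; rewrite divff// normr_eq0 a0.
pose le_c (ys : m.-tuple R) := [forall l, ((tnth ys l)%:E <= c ord0 l)%E].
have mle : measurable_fun [set: m.-tuple RT] le_c.
  exact: (measurable_box (fun l => measurable_lee_cst (c ord0 l))).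
(* The strict and the weak box differ only where some coordinate equals its bound. *)
apply: (integral_tuple_eq_off_hyperplanes (r := c ord0)) => //.
- by apply: measurable_fun_ifT => //; exact: measurable_mvnormal_pdf.
- by move=> ys; case: ifP => // _; rewrite lee_fin mvnormal_pdf_ge0.
move=> ys ysc; rewrite /g /f.
have -> : below ys = le_c ys.
  by apply: eq_forallb => l; rewrite lt_neqAle ysc.
by rewrite /le_c; case: ifP => _; rewrite ?mul1e ?mul0e.
Qed.

End TriangularNormalCdf.

(** * The second moment of a centered normal law *)

Section NormalSecondMoment.
Context (R : realType) (s : R) (s0 : 0 < s).
Local Notation RT := (measurableTypeR R).
Local Notation mu := (@lebesgue_measure R).
Local Notation p := (normal_pdf 0 s).

Lemma normal_pdf0E : p = fun x => normal_peak s * expR (- x ^+ 2 / (s ^+ 2 *+ 2)).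
Proof.
rewrite normal_pdfE ?gt_eqF// /normal_fun; apply/funext => x.
by rewrite subr0.
Qed.

Lemma normal_pdf0N (x : R) : p (- x) = p x.
Proof. by rewrite normal_pdf0E sqrrN. Qed.

Lemma is_derive_normal_pdf (x : R) : is_derive x 1 p (- (x / s ^+ 2) * p x).
Proof.
rewrite normal_pdf0E.
have dq : is_derive x 1 (fun y : R => - y ^+ 2 / (s ^+ 2 *+ 2)) (- (x / s ^+ 2)).
  have -> : (fun y : R => - y ^+ 2 / (s ^+ 2 *+ 2)) =
      (- (s ^+ 2 *+ 2)^-1) \*: (fun y : R => y ^+ 2).
    by apply/funext => y /=; rewrite /GRing.scale /= mulNr mulrC mulNr.
  apply: is_derive_eq; rewrite /GRing.scale /=; field.
  by rewrite gt_eqF.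
have de := @is_derive1_comp R expR (fun y : R => - y ^+ 2 / (s ^+ 2 *+ 2)) x _ _
  (is_derive_expR _) dq.
have -> : (fun y : R => normal_peak s * expR (- y ^+ 2 / (s ^+ 2 *+ 2))) =
    normal_peak s \*: (expR \o (fun y : R => - y ^+ 2 / (s ^+ 2 *+ 2))).
  by apply/funext.
by apply: is_derive_eq; rewrite /GRing.scale /=; ring.
Qed.

Lemma is_derive_id_normal_pdf (x : R) :
  is_derive x 1 (fun y => - s ^+ 2 * (y * p y)) ((x ^+ 2 - s ^+ 2) * p x).
Proof.
have dp := is_derive_normal_pdf x.
have -> : (fun y => - s ^+ 2 * (y * p y)) = (- s ^+ 2) \*: (id * p) by apply/funext.
apply: is_derive_eq; rewrite /GRing.scale /=; field.
by rewrite gt_eqF.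
Qed.

(** From [1 + t <= expR t] the Gaussian factor is at most [(s ^+ 2 *+ 2) / x ^+ 2], so the absolute
    value is at most [C / x]. *)
Lemma cvg_id_normal_pdf : - s ^+ 2 * (x * p x) @[x --> +oo%R] --> (0 : R).
Proof.
apply/cvgr0Pnorm_lt => e e0.
pose C := s ^+ 2 * (normal_peak s * (s ^+ 2 *+ 2)).
near=> x.
have x0 : 0 < x by near: x; exact: nbhs_pinfty_gt.
have xe : C / e < x by near: x; apply: nbhs_pinfty_gt; exact: num_real.
have s20 : 0 < s ^+ 2 *+ 2 by rewrite pmulrn_lgt0// exprn_gt0.
have E : expR (- x ^+ 2 / (s ^+ 2 *+ 2)) <= (s ^+ 2 *+ 2) / x ^+ 2.
  rewrite mulNr expRN -[leRHS]invrK invf_div lef_pV2 ?posrE ?expR_gt0//; last first.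
    by rewrite divr_gt0// exprn_gt0.
  by apply: le_trans (expR_ge1Dx _); rewrite lerDr.
rewrite mulNr normrN ger0_norm; last first.
  by rewrite mulr_ge0 ?sqr_ge0// mulr_ge0 ?(ltW x0)// normal_pdf_ge0.
rewrite normal_pdf0E.
apply: (@le_lt_trans _ _ (C / x)); last first.
  by rewrite ltr_pdivrMr// mulrC -ltr_pdivrMr.
apply: (@le_trans _ _
    (s ^+ 2 * (x * (normal_peak s * ((s ^+ 2 *+ 2) / x ^+ 2))))).
  by do 3 (rewrite ler_wpM2l ?sqr_ge0 ?(ltW x0) ?normal_peak_ge0//).
by rewrite le_eqVlt /C; apply/orP; left; apply/eqP; field; rewrite gt_eqF.
Unshelve. all: by end_near. Qed.



Lemma continuous_poly_normal_pdf (q : R -> R) :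
  continuous q -> continuous (fun x => q x * p x).
Proof.
move=> cq x; apply: (@cvgM R _ (nbhs x) _ q p); first exact: cq.
by apply: continuous_normal_pdf; rewrite gt_eqF.
Qed.

Let continuous_sqr : continuous (fun x : R => x ^+ 2).
Proof. exact: exprn_continuous. Qed.

(* (x ^+ 2 - s ^+ 2) * p x is the derivative of - s ^+ 2 * (x * p x).  As it changes
   sign at s, the fundamental theorem is applied on either side of s, where both
   integrals are v. *)
Let v : R := s ^+ 2 * (s * p s).

Lemma integral_left_of_sd :
  (\int[mu]_(x in `[0%R, s]) ((s ^+ 2 - x ^+ 2) * p x)%:E = v%:E)%E.
Proof.
pose F := - (fun x : R => - s ^+ 2 * (x * p x)).
have dF (x : R) : is_derive x 1 F ((s ^+ 2 - x ^+ 2) * p x).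
  have := is_derive_id_normal_pdf x => d.
  by apply: is_derive_eq; rewrite -mulNr opprB.
have cF (x : R) : F y @[y --> x] --> F x.
  by apply/differentiable_continuous/derivable1_diffP; case: (dF x).
rewrite (@continuous_FTC2 _ _ F)//.
- by rewrite /F !fctE mul0r mulr0 oppr0 sube0 /v; congr (_%:E); ring.
- apply: continuous_subspaceT; apply: continuous_poly_normal_pdf => x.
  by apply: cvgB; [exact: cvg_cst|exact: continuous_sqr].
- split; first by move=> x _; case: (dF x).
  + exact: cvg_at_right_filter.
  + exact: cvg_at_left_filter.
- by move=> x _; rewrite derive1E; apply: derive_val.
Qed.

Lemma integral_right_of_sd :
  (\int[mu]_(x in `[s, +oo[) ((x ^+ 2 - s ^+ 2) * p x)%:E = v%:E)%E.
Proof.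
pose F (x : R) := - s ^+ 2 * (x * p x).
have cF (x : R) : F y @[y --> x] --> F x.
  apply/differentiable_continuous/derivable1_diffP.
  by case: (is_derive_id_normal_pdf x).
rewrite (@ge0_continuous_FTC2y _ _ F _ 0).
- by rewrite /F /v -EFinB; congr (_%:E); ring.
- move=> x sx; rewrite mulr_ge0 ?normal_pdf_ge0// subr_ge0.
  by rewrite ler_sqr ?nnegrE// ?(ltW s0)// (le_trans (ltW s0)).
- apply: continuous_subspaceT; apply: continuous_poly_normal_pdf => x.
  by apply: cvgB; [exact: continuous_sqr|exact: cvg_cst].
- exact: cvg_id_normal_pdf.
- by move=> x _; case: (is_derive_id_normal_pdf x).
- exact: cvg_at_right_filter.
- by move=> x _; rewrite derive1E; have d := is_derive_id_normal_pdf x; apply: derive_val.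
Qed.

(** The integrals of [s ^+ 2 * p x] and [x ^+ 2 * p x] differ by [v] on each side of [s], in
    opposite directions. Hence they agree on the positive half-line and, by evenness, on the whole
    line, where the former is [s ^+ 2]. *)
Lemma integral_sqr_normal_pdf :
  (\int[mu]_x (x ^+ 2 * p x)%:E = (s ^+ 2)%:E)%E.
Proof.
have msq (q : R -> R) (A : set RT) : continuous q -> measurable A ->
    measurable_fun A (fun x : RT => (q x * p x)%:E).
  move=> cq mA; apply/measurable_funTS/measurable_EFinP.
  by apply: continuous_measurable_fun; exact: continuous_poly_normal_pdf.
have half (q : R -> R) : (forall x, 0 <= q x) -> continuous q ->
    (forall x, q (- x) = q x) ->
  (\int[mu]_x (q x * p x)%:E =
   2%:E * (\int[mu]_(x in `[0%R, s]) (q x * p x)%:E +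
           \int[mu]_(x in `[s, +oo[) (q x * p x)%:E))%E.
  move=> q0 cq qN; rewrite ge0_symfun_integralT.
  - rewrite -set_itvcy (@itv_bndbnd_setU _ _ _ (BRight s))// ?bnd_simp ?(ltW s0)//.
    rewrite ge0_integral_setU//.
    + by rewrite integral_itv_obnd_cbnd//; exact: msq.
    + by apply: msq => //; exact: measurableU.
    + by move=> x _; rewrite lee_fin mulr_ge0// normal_pdf_ge0.
    + apply/disj_set2P/seteqP; split => x //=; rewrite !in_itv /= andbT.
      by move=> [/andP[_ xs]]; rewrite ltNge xs.
  - by move=> x; rewrite mulr_ge0// normal_pdf_ge0.
  - exact: continuous_poly_normal_pdf.
  - by move=> x /=; rewrite qN normal_pdf0N.
have cc : continuous (fun _ : R => s ^+ 2) by move=> x; exact: cvg_cst.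
transitivity (\int[mu]_x (s ^+ 2 * p x)%:E)%E; last first.
  under eq_integral do rewrite EFinM.
  rewrite ge0_integralZl//.
  - by rewrite integral_normal_pdf mule1.
  - by apply/measurable_EFinP; exact: measurable_normal_pdf.
  - by move=> x _; rewrite lee_fin normal_pdf_ge0.
  - by rewrite lee_fin sqr_ge0.
rewrite (half (fun x => x ^+ 2))//; first last.
- by move=> x; rewrite sqrrN.
- by move=> x; exact: sqr_ge0.
rewrite (half (fun=> s ^+ 2))//; last by move=> x; exact: sqr_ge0.
have -> : (\int[mu]_(x in `[0%R, s]) (s ^+ 2 * p x)%:E =
    \int[mu]_(x in `[0%R, s]) (x ^+ 2 * p x)%:E + v%:E)%E.
  rewrite -integral_left_of_sd -ge0_integralD//.
  - by apply: eq_integral => x _; rewrite -EFinD; congr (_%:E); ring.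
  - by move=> x _; rewrite lee_fin mulr_ge0 ?sqr_ge0 ?normal_pdf_ge0.
  - exact: msq.
  - move=> x /=; rewrite in_itv /= => /andP[x0 xs].
    by rewrite lee_fin mulr_ge0 ?normal_pdf_ge0// subr_ge0 ler_sqr ?nnegrE// ltW.
  - by apply: msq => // x; apply: cvgB; [exact: cvg_cst|exact: continuous_sqr].
have -> : (\int[mu]_(x in `[s, +oo[) (x ^+ 2 * p x)%:E =
    \int[mu]_(x in `[s, +oo[) (s ^+ 2 * p x)%:E + v%:E)%E.
  rewrite -integral_right_of_sd -ge0_integralD//.
  - by apply: eq_integral => x _; rewrite -EFinD; congr (_%:E); ring.
  - by move=> x _; rewrite lee_fin mulr_ge0 ?sqr_ge0 ?normal_pdf_ge0.
  - exact: msq.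
  - move=> x /=; rewrite in_itv /= andbT => sx.
    rewrite lee_fin mulr_ge0 ?normal_pdf_ge0// subr_ge0 ler_sqr ?nnegrE// ?(ltW s0)//.
    by rewrite (le_trans (ltW s0)).
  - by apply: msq => // x; apply: cvgB; [exact: continuous_sqr|exact: cvg_cst].
by rewrite addeA addeAC.
Qed.

End NormalSecondMoment.

(** * Square integrability and odd moments of normal variables *)

Section NormalMoments.
Context (R : realType) (d : measure_display) (Omega : measurableType d).
Variables (P : probability Omega R) (s : R).
Hypothesis s0 : 0 < s.
Local Notation RT := (measurableTypeR R).
Local Notation mu := (@lebesgue_measure R).

Definition has_normal_law (X : {RV P >-> R}) : Prop :=
  forall A : set R, measurable A -> distribution P X A = normal_prob 0 s A.

Lemma normal_sqr_integral (X : {RV P >-> R}) : has_normal_law X ->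
  (\int[P]_w (X w ^+ 2)%:E = (s ^+ 2)%:E)%E.
Proof.
move=> nX; have msqr : measurable_fun [set: RT] (fun x : RT => (x ^+ 2)%:E : \bar R).
  by apply/measurable_EFinP; exact: measurable_funX.
have sqr0 (x : R) : (0 <= (x ^+ 2)%:E)%E by rewrite lee_fin sqr_ge0.
have mX : measurable_fun [set: Omega] (X : Omega -> RT) by exact: (measurable_funPT X).
have /= <- := ge0_integral_pushforward mX P measurableT msqr (fun x _ => sqr0 x).
rewrite -(integral_sqr_normal_pdf s0).
under [RHS]eq_integral do rewrite EFinM.
rewrite -integral_normal_prob//.
by apply: eq_measure_integral => A mA _; exact: nX.
Qed.

Lemma normal_Lfun2 (X : {RV P >-> R}) : has_normal_law X ->
  (X : Omega -> R) \in Lfun P 2%:E.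
Proof.
move=> nX; rewrite inE; apply/andP; split; rewrite inE /=.
  exact: measurable_funPT.
rewrite /finite_norm unlock poweR_lty//.
rewrite (eq_integral (fun w => (X w ^+ 2)%:E)) ?normal_sqr_integral ?ltry//.
by move=> w _ /=; rewrite powR_mulrn// real_normK// num_real.
Qed.

(** Reflecting the first variable preserves its even density and exchanges the positive and negative
    parts of [g], so these have equal integrals. The case of one variable gives means, that of two
    gives covariances. *)
Lemma normal_integral_odd m (X : nat -> {RV P >-> R}) (g : m.+1.-tuple R -> R) :
  independent_upto m.+1 X ->
  (forall l, (l < m.+1)%N -> has_normal_law (X l)) ->
  measurable_fun [set: m.+1.-tuple RT] g ->
  (forall y (ys : m.-tuple R), g [tuple of - y :: ys] = - g [tuple of y :: ys]) ->
  P.-integrable setT (fun w => (g [tuple X l w | l < m.+1])%:E) ->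
  (\int[P]_w (g [tuple X l w | l < m.+1])%:E = 0)%E.
Proof.
move=> ind nX mg godd ig; rewrite integralE.
suff E : (\int[P]_w ((fun w => (g [tuple X l w | l < m.+1])%:E)^\+ w) =
      \int[P]_w ((fun w => (g [tuple X l w | l < m.+1])%:E)^\- w))%E.
  by rewrite -E subee// integrable_pos_fin_num.
pose gp := (fun ys => (g ys)%:E)^\+%E.
pose gn := (fun ys => (g ys)%:E)^\-%E.
have mEg : measurable_fun [set: m.+1.-tuple RT] (fun ys => (g ys)%:E).
  exact/measurable_EFinP.
have mgp : measurable_fun [set: m.+1.-tuple RT] gp by exact: measurable_funepos.
have mgn : measurable_fun [set: m.+1.-tuple RT] gn by exact: measurable_funeneg.
have gp0 ys : (0 <= gp ys)%E by exact: funepos_ge0.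
have gn0 ys : (0 <= gn ys)%E by exact: funeneg_ge0.
transitivity (\int[P]_w gp [tuple X l w | l < m.+1])%E.
  by apply: eq_integral => w _; rewrite /gp !funeposE.
transitivity (\int[P]_w gn [tuple X l w | l < m.+1])%E; last first.
  by apply: eq_integral => w _; rewrite /gn !funenegE.
rewrite (independent_normals_integral ind nX mgp gp0).
rewrite (independent_normals_integral ind nX mgn gn0).
pose J (h : m.+1.-tuple R -> \bar R) (ys : m.+1.-tuple R) :=
  (h ys * (\prod_(l < m.+1) normal_pdf 0 s (tnth ys l))%:E)%E.
pose G h (y : R) := integral_tuple (fun ys : m.-tuple R => J h [tuple of y :: ys]).
rewrite -[LHS]/(\int[mu]_y G gp y)%E -[RHS]/(\int[mu]_y G gn y)%E.
have J0 h ys : (forall ys, 0 <= h ys)%E -> (0 <= J h ys)%E.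
  move=> h0; rewrite mule_ge0// lee_fin; apply: prodr_ge0 => l _.
  exact: normal_pdf_ge0.
have mG h : measurable_fun [set: m.+1.-tuple RT] h -> (forall ys, 0 <= h ys)%E ->
    measurable_fun [set: RT] (G h).
  move=> mh h0; apply: measurable_integral_tuple_cons => [|ys]; last exact: J0.
  by apply: emeasurable_funM => //; exact: measurable_prod_normal_pdf.
have Ggp0 y : (0 <= G gp y)%E by apply: integral_tuple_ge0 => ys; exact: J0.
have N10 : (-1 : R) != 0 by rewrite oppr_eq0 oner_neq0.
(* The reflection is the affine substitution of slope -1, with Jacobian 1. *)
have := integral_affine 0 N10 (mG gp mgp gp0) Ggp0.
rewrite normrN1 invr1 mul1e => <-.
apply: eq_integral => y _; congr integral_tuple; apply/funext => ys.
rewrite mulN1r addr0 /J; congr (_ * _%:E)%E.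
  by rewrite /gp /gn funeposE funenegE godd EFinN.
rewrite !big_ord_recl !tnth0 (normal_pdf0N s0); congr (_ * _).
by apply: eq_bigr => l _; rewrite !tnthS.
Qed.

End NormalMoments.

(** * Covariances of linear combinations of independent normals *)

Section NormalCovariance.
Context (R : realType) (d : measure_display) (Omega : measurableType d).
Variables (P : probability Omega R) (s : R).
Hypothesis s0 : 0 < s.
Local Notation RT := (measurableTypeR R).

Let fin_PT : P setT \is a fin_num := fin_num_measure P _ measurableT.

Lemma normal_expectation (X : {RV P >-> R}) : has_normal_law s X -> ('E_P[X] = 0)%E.
Proof.
move=> nX; rewrite unlock.
have ind : independent_upto 1 (fun=> X).
  move=> A mA; rewrite big_ord1; congr (P _); apply/seteqP; split => w /=.
    by move=> /(_ 0%N isT).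
  by move=> H [].
have mg : measurable_fun [set: 1.-tuple RT] (fun ys : 1.-tuple RT => tnth ys ord0).
  exact: measurable_tnth.
have E w : tnth [tuple X w | l < 1] ord0 = X w by rewrite tnth_mktuple.
have iX : P.-integrable setT (fun w => (tnth [tuple X w | l < 1] ord0)%:E).
  under eq_fun do rewrite E.
  by apply/Lfun1_integrable; exact: (Lfun_subset12 fin_PT (normal_Lfun2 s0 nX)).
have := normal_integral_odd s0 ind (fun _ _ => nX) mg _ iX.
under eq_integral do rewrite E.
by apply => y ys; rewrite !tnth0.
Qed.

Lemma normal_covariance_self (X : {RV P >-> R}) : has_normal_law s X ->
  covariance P X X = (s ^+ 2)%:E.
Proof.
move=> nX; have X2 := normal_Lfun2 s0 nX; have X1 := Lfun_subset12 fin_PT X2.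
rewrite covarianceE//; last exact: Lfun2_mul_Lfun1.
rewrite normal_expectation// mul0e sube0 unlock -(normal_sqr_integral s0 nX).
by apply: eq_integral => w _; rewrite expr2.
Qed.

(** A pair as a sequence, for use with [independent_upto 2], which looks only at indices 0 and 1. *)
Definition pair_seq (X Y : {RV P >-> R}) (l : nat) : {RV P >-> R} :=
  if l is 0 then X else Y.

(** The means vanish, and the product of two coordinates is odd in the first one, so
    [normal_integral_odd] applies. *)
Lemma normal_covariance_independent (X Y : {RV P >-> R}) :
  has_normal_law s X -> has_normal_law s Y -> independent_upto 2 (pair_seq X Y) ->
  covariance P X Y = 0%E.
Proof.
move=> nX nY ind; have X2 := normal_Lfun2 s0 nX; have Y2 := normal_Lfun2 s0 nY.
have XY1 := Lfun2_mul_Lfun1 X2 Y2.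
rewrite covarianceE//; try exact: Lfun_subset12.
rewrite (normal_expectation nX) mul0e sube0 unlock.
pose g (ys : 2.-tuple R) := tnth ys ord0 * tnth ys (lift ord0 ord0).
have mg : measurable_fun [set: 2.-tuple RT] g.
  by apply: measurable_funM; exact: measurable_tnth.
have E w : g [tuple pair_seq X Y l w | l < 2] = X w * Y w.
  by rewrite /g !tnth_mktuple.
have iX : P.-integrable setT (fun w => (g [tuple pair_seq X Y l w | l < 2])%:E).
  under eq_fun do rewrite E.
  exact/Lfun1_integrable.
have nXY l : (l < 2)%N -> has_normal_law s (pair_seq X Y l) by case: l.
have := normal_integral_odd s0 ind nXY mg _ iX.
under eq_integral do rewrite E.
by apply => y ys; rewrite /g !tnth0 !tnthS mulNr.
Qed.

Lemma Lfun2_linear_combination (m : nat) (a : nat -> R) (X : nat -> Omega -> R) :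
  (forall j, (j < m)%N -> X j \in Lfun P 2%:E) ->
  (fun w => \sum_(j < m) a j * X j w) \in Lfun P 2%:E.
Proof.
elim: m => [|m IH] X2.
  rewrite (_ : (fun _ => _) = cst 0); first exact: Lfun_cst.
  by apply/funext => w; rewrite big_ord0.
rewrite (_ : (fun _ => _) = (fun w => \sum_(j < m) a j * X j w) \+ (a m \o* X m)).
  have Xm2 : a m \o* X m \in Lfun P 2%:E.
    by apply: (@Lfun_scale _ _ _ P); [rewrite ler1n|exact: X2].
  apply: rpredD => //; first by rewrite lee_fin ler1n.
  by move=> le12; apply: IH => j jm; apply: X2; exact: ltnW.
by apply/funext => w; rewrite big_ord_recr /= [X in _ + X]mulrC.
Qed.

Lemma covariance_suml m (a : nat -> R) (X : nat -> Omega -> R) (Y : Omega -> R) :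
  (forall j, (j < m)%N -> X j \in Lfun P 2%:E) -> Y \in Lfun P 2%:E ->
  covariance P (fun w => \sum_(j < m) a j * X j w) Y =
  (\sum_(j < m) (a j)%:E * covariance P (X j) Y)%E.
Proof.
elim: m => [|m IH] X2 Y2.
  rewrite big_ord0 (_ : (fun _ => _) = cst 0) ?covariance_cst_l//.
  by apply/funext => w; rewrite big_ord0.
have Xm2 := X2 m (ltnSn m).
have Xlt2 j : (j < m)%N -> X j \in Lfun P 2%:E by move=> jm; apply: X2; exact: ltnW.
rewrite (_ : (fun _ => _) = (fun w => \sum_(j < m) a j * X j w) \+ (a m \o* X m)).
  rewrite covarianceDl//; first last.
  - by apply: Lfun_scale; rewrite ?ler1n.
  - exact: Lfun2_linear_combination.
  rewrite IH// big_ord_recr /= covarianceZl//; try exact: Lfun_subset12.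
  exact: Lfun2_mul_Lfun1.
by apply/funext => w; rewrite big_ord_recr /= [X in _ + X]mulrC.
Qed.

(** Bilinearity leaves a double sum in which only the diagonal terms, the variances, survive. *)
Lemma covariance_linear_combinations m (a b : nat -> R) (X : nat -> {RV P >-> R}) :
  (forall j, (j < m)%N -> has_normal_law s (X j)) ->
  (forall j k, (j < m)%N -> (k < m)%N -> j != k ->
     independent_upto 2 (pair_seq (X j) (X k))) ->
  covariance P (fun w => \sum_(j < m) a j * X j w) (fun w => \sum_(k < m) b k * X k w)
  = (s ^+ 2 * \sum_(j < m) a j * b j)%:E.
Proof.
move=> nX ind; have X2 j : (j < m)%N -> (X j : Omega -> R) \in Lfun P 2%:E.
  by move=> jm; exact: (normal_Lfun2 s0 (nX j jm)).
rewrite (covariance_suml a X2 (Lfun2_linear_combination b X2)).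
rewrite mulr_sumr -sumEFin; apply: eq_bigr => j _.
rewrite covarianceC (covariance_suml b X2 (X2 j (ltn_ord j))) (bigD1 j)//=.
rewrite (normal_covariance_self (nX j (ltn_ord j))) big1 ?adde0.
  by rewrite -!EFinM; congr (_%:E); ring.
move=> k kj; rewrite (normal_covariance_independent (nX k _) (nX j _)) ?mule0//.
exact: ind.
Qed.

End NormalCovariance.

(** * Standardized prices as linear forms, and the crossing event *)

Section CrossingTime.
Context (d : measure_display) (Omega : measurableType d) (R : realType).
Variable P : probability Omega R.
Variables (theta K sigma dt : R) (N : nat) (eps : nat -> {RV P >-> R}).
Local Notation rho := (1 - dt * K).

Lemma le_standardized (z mean sd : R) (y : \bar R) : 0 < sd ->
  (((z - mean) / sd)%:E <= (y - mean%:E) * (sd^-1)%:E)%E = (z%:E <= y)%E.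
Proof.
move=> sd0; have sdV : (0 < (sd^-1)%:E)%E by rewrite lte_fin invr_gt0.
by rewrite EFinM lee_pmul2r// EFinB leeD2rE.
Qed.

(** The model sums innovations backwards from the current date; reversing the sum attaches index [j]
    to the innovation at [n + j.+1] for every [l], which makes the coefficients lower triangular. *)
Lemma std_price_linear (n l : nat) (x : R) (w : Omega) :
  std_price theta K sigma dt eps n (n + l.+1) x w =
  \sum_(j < l.+1)
    sigma * rho ^+ (l - j) / price_sd K sigma dt n (n + l.+1) * eps (n + j.+1)%N w.
Proof.
rewrite /std_price /price /price_mean addrAC subrr add0r addKn big_mkord.
rewrite mulrAC mulr_sumr (reindex_inj rev_ord_inj) /=.
apply: eq_bigr => j _; have jl : (j <= l)%N by rewrite -ltnS.
rewrite subSS; have -> : (n + l.+1 - (l - j) = n + j.+1)%N by lia.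
by ring.
Qed.

(** Padding with zeros lets all coordinates sum over the same [m] innovations, the form that
    [covariance_linear_combinations] takes. *)
Lemma std_price_neg_lower_mx m (n : nat) (x : R) (l : 'I_m) (w : Omega)
    (a : nat -> nat -> R) :
  (forall l j, a l j =
     - (sigma * rho ^+ (l - j) / price_sd K sigma dt n (n + l.+1))) ->
  std_price theta K sigma dt eps n (n + l.+1) x w =
  \sum_(j < m) (if (j <= l)%N then - a l j else 0) * eps (n + j.+1)%N w.
Proof.
move=> aE; rewrite std_price_linear.
rewrite (big_ord_widen _ (fun j => sigma * rho ^+ (l - j) /
  price_sd K sigma dt n (n + l.+1) * eps (n + j.+1)%N w) (ltn_ord l)) big_mkcond /=.
apply: eq_bigr => j _; rewrite ltnS aE opprK.
by case: ifP => _; rewrite ?mul0r.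
Qed.

Hypotheses (dt_gt0 : 0 < dt) (sigma_gt0 : 0 < sigma) (stable : `|1 - dt * K| < 1).

Lemma grid_lt (j k : nat) : (grid dt j < grid dt k) = (j < k)%N.
Proof. by rewrite /grid ltr_pM2r// ltr_nat. Qed.

Lemma grid_le (j k : nat) : (grid dt j <= grid dt k) = (j <= k)%N.
Proof. by rewrite /grid ler_pM2r// ler_nat. Qed.

(** The infinite threshold at [N] ensures that some date is a hit, so the infimum is attained at the
    least hit [k0]; it equals [grid dt i] exactly when [k0 = i], the grid being strictly
    increasing. *)
Lemma crossing_time_eq_grid (b : nat -> \bar R) (n i : nat) (x : R) (w : Omega) :
  (n < i <= N)%N -> b N = +oo%E ->
  crossing_time theta K sigma dt N eps b n x w = grid dt i <->
  ((price theta K sigma dt eps n i x w)%:E <= b i)%E /\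
  (forall k, (n < k < i)%N -> (b k < (price theta K sigma dt eps n k x w)%:E)%E).
Proof.
move=> /andP[ni iN] bN.
pose below k := ((price theta K sigma dt eps n k x w)%:E <= b k)%E.
pose hit k := [&& (k <= N)%N, (n < k)%N & below k].
have exhit : exists k, hit k.
  by exists N; rewrite /hit leqnn (leq_trans ni iN) /below bN leey.
case: (ex_minnP exhit) => k0 /and3P[k0N nk0 bk0] k0min.
have -> : crossing_time theta K sigma dt N eps b n x w = grid dt k0.
  rewrite /crossing_time; set S := [set _ | _ in _].
  have Sk0 : S (grid dt k0) by exists k0 => //; split; rewrite ?grid_lt.
  have lbS : lbound S (grid dt k0).
    move=> _ [k [kN nk bk] <-]; rewrite grid_le; apply: k0min.
    by rewrite /hit kN -grid_lt nk.
  apply/eqP; rewrite eq_le; apply/andP; split.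
    by apply: ge_inf => //; exists (grid dt k0).
  by apply: lb_le_inf => //; exists (grid dt k0).
split=> [/eqP|[bi ltb]].
  rewrite eq_le !grid_le -eqn_leq => /eqP k0i.
  rewrite -k0i; split => // k /andP[nk kk0]; rewrite ltNge; apply/negP => bk.
  have kN : (k <= N)%N by rewrite (leq_trans (ltnW kk0)).
  by have := k0min k; rewrite /hit kN nk /below bk leqNgt kk0 => /(_ isT).
congr (grid dt _); apply/eqP; rewrite eqn_leq k0min /hit ?iN ?ni ?/below ?bi//=.
rewrite leqNgt; apply/negP => k0i; have := ltb k0.
by rewrite nk0 k0i ltNge [X in ~~ X]bk0 => /(_ isT).
Qed.

Lemma price_sd_gt0 (n k : nat) : (n < k)%N -> 0 < price_sd K sigma dt n k.
Proof.
move=> nk; rewrite sqrtr_gt0 /price_var exprM.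
have r1 : rho ^+ 2 < 1 by rewrite -real_normK ?num_real// exprn_ilt1.
rewrite mulr_gt0 ?divr_gt0 ?subr_gt0// ?mulr_gt0 ?exprn_gt0//.
by rewrite exprn_ilt1 ?sqr_ge0// subn_eq0 -ltnNge.
Qed.

End CrossingTime.

(** * Independence of consecutive innovations and of pairs *)

Section IndependenceReindexing.
Context (d : measure_display) (Omega : measurableType d) (R : realType).
Variables (P : probability Omega R) (N : nat) (X : nat -> {RV P >-> R}).
Hypothesis ind : mutually_independent [pred i : nat | (1 <= i <= N)%N] X.

Lemma mutually_independent_upto (n m : nat) : (n + m <= N)%N ->
  independent_upto m (fun l => X (n + l.+1)%N).
Proof.
move=> nmN A mA.
(* Subtracting [n.+1] recovers the position [l] from the grid index [n + l.+1]. *)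
have := @ind [seq (n + l.+1)%N | l <- index_iota 0 m] (fun i => A (i - n.+1)%N).
rewrite map_inj_uniq ?iota_uniq => [|j k]; last by lia.
have AE l : A (n + l.+1 - n.+1)%N = A l by rewrite addnS subSS addKn.
move=> /(_ isT); rewrite big_map big_mkord.
under [in X in _ -> _ -> X]eq_bigr do rewrite AE.
move=> <- //; last first.
  by move=> i /mapP[l]; rewrite mem_index_iota !inE => lm ->; lia.
congr (P _); apply/seteqP; split => w /= H.
  by move=> i /mapP[l]; rewrite mem_index_iota /= => lm ->; rewrite AE; exact: H.
move=> l lm; rewrite -AE; apply: H.
by apply: (map_f (fun l => (n + l.+1)%N)); rewrite mem_index_iota.
Qed.

Lemma mutually_independent_pair (j k : nat) :
  (1 <= j <= N)%N -> (1 <= k <= N)%N -> j != k ->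
  independent_upto 2 (pair_seq (X j) (X k)).
Proof.
move=> jN kN jk A mA.
have := @ind [:: j; k] (fun i => if i == j then A 0%N else A 1%N).
rewrite /= inE jk big_cons big_seq1 eqxx eq_sym (negbTE jk) => /(_ isT).
rewrite !big_ord_recl big_ord0 mule1 => <-; last 2 first.
- by move=> i; rewrite !inE => /orP[] /eqP ->.
- by move=> i; case: ifP.
congr (P _); apply/seteqP; split => w /= H.
  move=> i; rewrite !inE => /orP[] /eqP ->.
    by rewrite eqxx; exact: (H 0%N).
  by rewrite eq_sym (negbTE jk); exact: (H 1%N).
move=> [|[|//]] _ /=.
  by have := H j; rewrite inE !eqxx; exact.
by have := H k; rewrite !inE eqxx orbT eq_sym (negbTE jk); exact.
Qed.

End IndependenceReindexing.

(** * The crossing probability as a difference of two distribution functions *)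

Theorem lemma2 (R : realType) (d : measure_display) (Omega : measurableType d)
  (P : probability Omega R) (T theta K sigma dt : R) (N : nat) (h : nat -> R)
  (eps : nat -> {RV P >-> R}) (b : nat -> \bar R)
  (dt_gt0 : 0 < dt) (N_def : N%:R = T / dt)
  (sigma_gt0 : 0 < sigma) (stable : `|1 - K * dt| < 1)
  (eps_normal : forall i : nat, (1 <= i <= N)%N ->
     forall A : set R, measurable A ->
       distribution P (eps i) A = normal_prob 0 (Num.sqrt dt) A)
  (eps_indep : mutually_independent [pred i : nat | (1 <= i <= N)%N] eps)
  (h_decr : forall i j : nat, (i <= j)%N -> (j < N)%N -> h j <= h i)
  (b_def : is_threshold theta K sigma dt N h eps b)
  (n i : nat) (n_lt_i : (n < i)%N) (i_le_N : (i <= N)%N) (x : R) :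
  let Sigma := std_cov theta K sigma dt eps n i x in
  let B := std_thresholds theta K sigma dt b n i x in
  let Bhat := std_thresholds_hat theta K sigma dt b n i x in
  P [set w | crossing_time theta K sigma dt N eps b n x w = grid dt i] =
  (mvnormal_cdf (map_mx -%E Bhat) Sigma - mvnormal_cdf (map_mx -%E B) Sigma)%E.
Proof.
move=> Sigma B Bhat; rewrite mulrC in stable.
pose sd l := price_sd K sigma dt n (n + l.+1).
have sd0 l : 0 < sd l by apply: price_sd_gt0 => //; lia.
pose X l := eps (n + l.+1)%N.
pose m := (i - n)%N.
have nmN : (n + m <= N)%N by rewrite /m subnKC// ltnW.
have dt_sqrt_gt0 : 0 < Num.sqrt dt by rewrite sqrtr_gt0.
have ind : independent_upto m X by exact: (mutually_independent_upto eps_indep).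
have nX l : (l < m)%N -> has_normal_law (Num.sqrt dt) (X l).
  by move=> lm A mA; apply: eps_normal => //; lia.
(* For [j > l] the exponent truncates to 0, but such entries are masked: the sums stop at [l], and
   [lower_mx] puts zeros there. *)
pose a l j := - (sigma * (1 - dt * K) ^+ (l - j) / sd l).
have a0 l : (l < m)%N -> a l l != 0.
  by move=> _; rewrite oppr_eq0 subnn expr0 mulr1 mulf_neq0 ?invr_eq0// gt_eqF.
(* U l is -Z_l: negating turns "above the threshold" into the "below" of a
   distribution function and leaves the covariance matrix unchanged. *)
pose U l w : R := \sum_(j < l.+1) a l j * X j w.
have UE l w : U l w = - std_price theta K sigma dt eps n (n + l.+1) x w.
  rewrite std_price_linear -[RHS]mulN1r mulr_sumr; apply: eq_bigr => j _.
  by rewrite mulN1r -mulNr.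
have SigmaE :
    Sigma = Num.sqrt dt ^+ 2 *: (lower_mx m a *m (lower_mx m a)^T).
  apply/matrixP => l k; rewrite !mxE.
  (* These are the coefficients of Z itself; the sign cancels in each product of two of them. *)
  pose coef (l j : nat) : R := if (j <= l)%N then - a l j else 0.
  have stdE (l' : 'I_m) : std_price theta K sigma dt eps n (n + l'.+1) x =
      fun w => \sum_(j < m) coef l' j * X j w.
    by apply/funext => w; exact: std_price_neg_lower_mx.
  rewrite !stdE (covariance_linear_combinations dt_sqrt_gt0 _ _ nX) /=.
    congr (_ * _); apply: eq_bigr => j _; rewrite !mxE /coef.
    by do 2 case: ifP => _; rewrite ?mul0r ?mulr0 ?mulrNN.
  move=> j k' jm km jk; apply: (mutually_independent_pair eps_indep); lia.
pose E (c : 'rV[\bar R]_m) := [set w | [forall l : 'I_m, ((U l w)%:E < c ord0 l)%E]].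
have PE c : P (E c) = mvnormal_cdf c Sigma.
  by rewrite SigmaE -(independent_normals_cdf c dt_sqrt_gt0 ind nX a0).
have mE c : measurable (E c).
  have -> : E c = \bigcap_(l in [set: 'I_m]) [set w | ((U l w)%:E < c ord0 l)%E].
    apply/seteqP; split => w /=; first by move=> /forallP H l _; exact: H.
    by move=> H; apply/forallP => l; exact: (H l I).
  apply: fin_bigcap_measurable => // l _.
  rewrite -[X in measurable X]setTI; apply: emeasurable_fun_infty_o => //.
  apply/measurable_EFinP; apply: measurable_sum => j.
  by apply: measurable_funM => //; exact: measurable_funPT.
have above l w : ((U l w)%:E < - std_threshold theta K sigma dt b n (n + l.+1) x)%E =
    (b (n + l.+1)%N < (price theta K sigma dt eps n (n + l.+1) x w)%:E)%E.
  by rewrite UE EFinN lteN2 !ltNge /std_threshold le_standardized// sd0.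
have EB w : E (map_mx -%E B) w <->
    forall k, (n < k <= i)%N -> (b k < (price theta K sigma dt eps n k x w)%:E)%E.
  split=> [/forallP H k /andP[nk ki]|H].
    (* Grid index [k] sits at coordinate [k - n.+1], since coordinate 0 stands for [n.+1]. *)
    have lm : (k - n.+1 < m)%N by lia.
    have := H (Ordinal lm); rewrite !mxE above /=.
    by rewrite (_ : n + (k - n.+1).+1 = k)%N//; lia.
  apply/forallP => l; rewrite !mxE above; apply: H.
  by have := ltn_ord l; lia.
have EBhat w : E (map_mx -%E Bhat) w <->
    forall k, (n < k < i)%N -> (b k < (price theta K sigma dt eps n k x w)%:E)%E.
  split=> [/forallP H k /andP[nk ki]|H].
    have lm : (k - n.+1 < m)%N by lia.
    have := H (Ordinal lm); rewrite !mxE /=.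
    rewrite (_ : n + (k - n.+1).+1 = k)%N; last by lia.
    rewrite ltn_eqF//.
    rewrite -[X in std_threshold _ _ _ _ _ _ X]
      (_ : n + (k - n.+1).+1 = k)%N; last by lia.
    by rewrite above (_ : n + (k - n.+1).+1 = k)%N//; lia.
  (* At the coordinate of [i] the negated entry is [+oo], so the strict inequality always holds and
     date [i] is left unconstrained. *)
  apply/forallP => l; rewrite !mxE; case: ifPn => [_|li].
    by rewrite /= ltry.
  rewrite above; apply: H.
  by have := ltn_ord l; rewrite [(_ < i)%N]ltn_neqAle li; lia.
rewrite -!PE.
have EBsub : E (map_mx -%E B) `<=` E (map_mx -%E Bhat).
  by move=> w /EB H; apply/EBhat => k /andP[nk ki]; apply: H; rewrite nk ltnW.
(* Since the events are nested and have finite measure, the difference of probabilities is the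
   probability of the set difference: above the thresholds before [i], but not also at [i]. *)
rewrite -[X in (_ - P X)%E](setIidr EBsub) -measureD//; last first.
  by rewrite ltey_eq fin_num_measure.
have [_ bN] := b_def.
have niN : (n < i <= N)%N by rewrite n_lt_i.
congr (P _); apply/seteqP; split => w.
  move=> /(crossing_time_eq_grid _ _ _ _ dt_gt0 _ _ niN bN)[bi ltb].
  split; first exact/EBhat.
  by move/EB => /(_ i); rewrite n_lt_i leqnn ltNge bi => /(_ isT).
move=> [/EBhat ltb notB]; apply/(crossing_time_eq_grid _ _ _ _ dt_gt0 _ _ niN bN).
split=> //; rewrite leNgt; apply/negP => ltbi; apply: notB; apply/EB.
move=> k /andP[nk]; rewrite leq_eqVlt => /predU1P[->//|ki].
by apply: ltb; rewrite nk.
Qed.
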